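(* Let $G$ be a finite, simple, connected graph of order $n$ which contains a cycle. Then $\beta(G)=n-g(G)+2$ if and only if $G$ is a cycle $C_n$, a complete graph $K_n$ with $n\geq 3$, or a complete bipartite graph $K_{r,s}$ with $r,s\geq 2$.
   Context: For vertices $x,y$ of a connected graph $G$, $d(x,y)$ denotes the length of a shortest $x$–$y$ path. A set $W\subseteq V(G)$ is a resolving set for $G$ if for every two distinct vertices $u,v\in V(G)$ there exists $w\in W$ with $d(u,w)\neq d(v,w)$. The metric dimension $\beta(G)$ is the minimum cardinality of a resolving set for $G$. The girth $g(G)$ is the length of a shortest cycle in $G$. *)

(* Defs.v *)
From mathcomp Require Import all_boot.
Set Implicit Arguments. Unset Strict Implicit. Unset Printing Implicit Defensive.

(* A finite simple graph: vertex type T : finType, adjacency e : rel T that is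
   symmetric and irreflexive (hypotheses of the theorem). *)

Section Graphs.
Variables (T : finType) (e : rel T).

Definition connected_graph : Prop := forall x y : T, connect e x y.

Definition walkb (x y : T) (k : nat) : bool :=
  [exists p : k.-tuple T, path e x p && (last x p == y)].

(* d(x,y): least k (< #|T|) such that an x-y walk of length k exists.
   The shortest walk is a shortest path, and in a connected graph it has
   length < #|T|; [find] on [iota 0 #|T|] returns that least k. *)
Definition dist (x y : T) : nat := find (walkb x y) (iota 0 #|T|).

Definition resolving (W : {set T}) : bool :=
  [forall u, forall v, (u != v) ==> [exists w in W, dist u w != dist v w]].

(* metric dimension: least cardinality of a resolving set
   (setT is always resolving, so the least k is <= #|T|) *)
Definition metric_dim : nat :=
  find (fun k => [exists W : {set T}, resolving W && (#|W| == k)]) (iota 0 #|T|.+1).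

Definition is_cycle (c : seq T) : bool := (3 <= size c) && uniq c && cycle e c.

Definition has_cycle : Prop := exists c : seq T, is_cycle c.

Definition girth : nat :=
  find (fun k => [exists c : k.-tuple T, is_cycle c]) (iota 0 #|T|.+1).

End Graphs.

Definition isomorphic (T T' : finType) (e : rel T) (e' : rel T') : Prop :=
  exists f : T -> T', bijective f /\ forall x y, e' (f x) (f y) = e x y.

Definition cycle_graph (n : nat) : rel 'I_n :=
  fun i j => (val j == (val i).+1 %% n) || (val i == (val j).+1 %% n).

Definition complete_graph (n : nat) : rel 'I_n := fun i j => i != j.

Definition complete_bipartite (r s : nat) : rel ('I_r + 'I_s)%type :=
  fun x y => match x, y with
             | inl _, inr _ | inr _, inl _ => true
             | _, _ => false
             end.

Arguments cycle_graph n : clear implicits.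
Arguments complete_graph n : clear implicits.
Arguments complete_bipartite r s : clear implicits.

(* Main.v *)
Require Import Defs.
From mathcomp Require Import all_boot.
From mathcomp Require Import zify.
Set Implicit Arguments. Unset Strict Implicit. Unset Printing Implicit Defensive.

(* Every vertex outside a set S is separated from all others by itself, so the
   complement of S resolves the graph as soon as it resolves S: such an S with
   g - 1 vertices gives metric_dim <= n - g + 1. Such an S exists unless the
   graph is in one of the three families.
   - g = 3: two vertices y, z of an induced path x y z, separated by x.
   - g = 4: if a b a' b' is a 4-cycle and z is adjacent to a but not to a', the
     vertices a, a', b' are separated by z and b. If there is no such z, then
     opposite vertices of 4-cycles are twins, which forces K_{r,s}.
   - g >= 5: two short paths with the same ends coincide, so a shortest cycle
     c_0 ... c_{g-1} is isometric. If it misses a vertex, it misses some z whose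
     only neighbour on it is c_0. For g <> 6, c_1 and c_{g-1} separate the other
     vertices of the cycle and z. For g = 6 they may confuse z and c_3; then
     c_1 and z separate the other vertices of the cycle, except that a common
     neighbour of z and c_3 may be needed to separate c_3 from c_5.
   Conversely, at most one vertex of each twin class can be left out of a
   resolving set, which settles K_n and K_{r,s}; in C_n two adjacent vertices
   resolve and a single one does not. *)

(** * Least witnesses found by searching an initial segment of the naturals *)

Section Find.
Variables (P : pred nat) (N : nat).

Lemma find_iota_le k : P k -> k <= N -> find P (iota 0 N) <= k.
Proof.
move=> Pk; rewrite leq_eqVlt => /orP[/eqP ->|ltkN].
  (* For [k = N] the bound is the default value: a failed [find] returns the length of the list. *)
  by rewrite (leq_trans (find_size _ _)) ?size_iota.
rewrite leqNgt; apply/negP => /(before_find 0).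
by rewrite nth_iota // Pk.
Qed.

Lemma find_iotaP k : P k -> k < N -> P (find P (iota 0 N)).
Proof.
move=> Pk ltkN.
have hasP : has P (iota 0 N) by apply/hasP; exists k; rewrite ?mem_iota.
have := nth_find 0 hasP.
by move: hasP; rewrite has_find size_iota => lt_f; rewrite nth_iota.
Qed.

End Find.

Lemma succ_modn n i : i < n -> i.+1 %% n = if i.+1 == n then 0 else i.+1.
Proof.
move=> lt_i; case: eqP => [->|neq_i]; first exact: modnn.
by rewrite modn_small; lia.
Qed.

(** Maps out of ordinals into [T] are the easy ones to write down; the cardinality bound makes such
    an injection bijective, and its inverse is the isomorphism. *)
Lemma isomorphic_inv (T T' : finType) (e : rel T) (e' : rel T') (h : T' -> T) :
    injective h -> #|T| <= #|T'| -> (forall x y, e (h x) (h y) = e' x y) ->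
  isomorphic e e'.
Proof.
move=> h_inj le_T hE; have [f fh hf] := inj_card_bij h_inj le_T.
by exists f; split=> [|x y]; [exists h | rewrite -hE !hf].
Qed.

(** * Paths, cycles and girth *)

Section Graph.
Variables (T : finType) (e : rel T).
Hypotheses (e_sym : symmetric e) (e_irr : irreflexive e).

Lemma adj_neq x y : e x y -> x != y.
Proof. by apply: contraTneq => ->; rewrite e_irr. Qed.

Lemma dist_le_path x p : path e x p -> dist e x (last x p) <= size p.
Proof.
move=> xp; case: (leqP (size p) #|T|) => [le_p | /ltnW lt_p].
  apply: find_iota_le => //.
  by apply/existsP; exists (in_tuple p); rewrite xp eqxx.
(* A walk longer than [#|T|] exceeds every value that [dist] can return. *)
by apply: leq_trans lt_p; rewrite -[leqRHS](size_iota 0) find_size.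
Qed.

Lemma girth_le s : is_cycle e s -> girth e <= size s.
Proof.
move=> cs; apply: find_iota_le; first by apply/existsP; exists (in_tuple s).
by case/andP: cs => /andP[_ /card_uniqP <-] _; rewrite leqW // max_card.
Qed.

Lemma girthP : has_cycle e -> exists2 s, is_cycle e s & size s = girth e.
Proof.
case=> s cs.
have : [exists c : (girth e).-tuple T, is_cycle e c].
  apply: (@find_iotaP (fun k => [exists c : k.-tuple T, is_cycle e c]) _ (size s)).
    by apply/existsP; exists (in_tuple s).
  by case/andP: cs => /andP[_ /card_uniqP <-] _; rewrite ltnS max_card.
by case/existsP=> c cc; exists c; rewrite ?size_tuple.
Qed.

Lemma girth_ge3 : has_cycle e -> 3 <= girth e.
Proof. by case/girthP=> s /andP[/andP[]] + _ _ => + <-. Qed.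

Lemma girth_le_card : has_cycle e -> girth e <= #|T|.
Proof.
by case/girthP=> s /andP[/andP[_ /card_uniqP s_uniq]] _ <-; rewrite -s_uniq max_card.
Qed.

Lemma triangle_free x y z : 3 < girth e -> e x y -> e y z -> e x z = false.
Proof.
move=> g3 xy yz; apply/negP => xz; move: g3; rewrite ltnNge => /negP; apply.
apply: (@girth_le [:: x; y; z]).
rewrite /is_cycle /= xy yz e_sym xz !inE negb_or.
by rewrite (adj_neq xy) (adj_neq xz) (adj_neq yz).
Qed.

(** Go out along [p] and return along the reverse of [q]. The last condition rules out going back
    and forth on one edge. *)
Lemma cycle_of_two_paths x v p q :
    path e x (rcons p v) -> path e x (rcons q v) ->
    uniq (x :: rcons p v) -> uniq (x :: rcons q v) ->
    ~~ has (mem q) p -> 0 < size p + size q ->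
  is_cycle e (x :: p ++ v :: rev q).
Proof.
move=> xp xq /= /andP[xNp p_uniq] /andP[xNq q_uniq] pq size_pq.
rewrite /is_cycle /= size_cat /= size_rev addnS !ltnS size_pq /=.
apply/andP; split.
  move: xNp p_uniq xNq q_uniq; rewrite !rcons_uniq cat_uniq /= rev_uniq has_rev.
  rewrite mem_cat !mem_rcons !inE !mem_rev !negb_or has_sym pq.
  by case/andP=> -> -> /andP[-> ->] /andP[_ ->] /andP[-> ->].
rewrite rcons_cat /= cat_path /= -rev_cons.
move: xp; rewrite rcons_path => /andP[-> ->] /=.
have := @rev_path _ e x (rcons q v); rewrite last_rcons belast_rcons => ->.
by rewrite (eq_path (e' := e)) // => a b; rewrite e_sym.
Qed.

(** Common first steps are stripped by induction. Once the paths diverge, the first vertex of one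
    that lies on the other closes a cycle no longer than their total length, hence shorter than the
    girth. *)
Lemma short_path_unique x p q :
    path e x p -> path e x q -> uniq (x :: p) -> uniq (x :: q) ->
    last x p = last x q -> size p + size q < girth e ->
  p = q.
Proof.
elim: p x q => [|a p IH] x [|b q] //.
- by move=> _ _ _ /= /andP[+ _] eq_x _; rewrite {1}eq_x mem_last.
- by move=> _ _ /= /andP[+ _] _ eq_x; rewrite -{1}eq_x mem_last.
move=> xp xq up uq eq_last lt_g.
case: (eqVneq a b) => [eq_ab | neq_ab].
  subst b; congr (_ :: _).
  move: xp xq up uq => /= /andP[_ ap] /andP[_ aq] /andP[_ up] /andP[_ uq].
  by apply: (IH a) => //; move: lt_g => /=; lia.
have : has (mem (b :: q)) (a :: p).
  apply/hasP; exists (last a p); first exact: mem_last.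
  by move: eq_last => /= ->; apply: mem_last.
have : head x (a :: p) != head x (b :: q) by [].
move: (a :: p) (b :: q) xp xq up uq lt_g {IH eq_last neq_ab} => {a b}p {}q.
move=> xp xq up uq lt_g + hpq; case/split_find: hpq xp up lt_g => v p1 p2 vq.
move: (vq : v \in q) => {}vq; case/splitPr: {q}vq xq uq => q1 q2.
rewrite -cat_rcons has_sym !has_cat !has_rcons !negb_or.
rewrite -!cat_cons !cat_path !cat_uniq !size_cat !size_rcons.
move=> /andP[xq _] /andP[uq _] pq /andP[xp _] /andP[up _] lt_g hneq.
suff /girth_le : is_cycle e (x :: p1 ++ v :: rev q1).
  by rewrite /= size_cat /= size_rev; move: lt_g; lia.
apply: cycle_of_two_paths => //.
  by rewrite has_sym; case/andP: pq => /andP[].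
(* Since the first steps differ, [p1] and [q1] are not both empty. *)
by case: p1 q1 hneq {pq xq uq xp up lt_g} => [|? ?] [|? ?] //=; rewrite eqxx.
Qed.

(** * Distances in a connected graph *)

Section Connected.
Hypothesis e_conn : connected_graph e.

Lemma shortest_path x y :
  exists p, [/\ path e x p, uniq (x :: p), last x p = y & size p = dist e x y].
Proof.
have [p [xp ltp py]] : exists p, [/\ path e x p, size p < #|T| & last x p = y].
  case/connectP: (e_conn x y) => q /shortenP[p xp up _] ->.
  by exists p; split=> //; have := max_card (mem (x :: p)); rewrite (card_uniqP up).
have : walkb e x y (dist e x y).
  apply: (find_iotaP _ ltp).
  by apply/existsP; exists (in_tuple p); rewrite /= xp py eqxx.
case/existsP=> q /andP[/shortenP[r xr ur sub_r] /eqP ry].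
exists r; split=> //; apply/eqP; rewrite eqn_leq -{2}ry dist_le_path // andbT.
have /andP[_ u_r] := ur.
by rewrite -(size_tuple q) uniq_leq_size.
Qed.

Lemma dist_sym x y : dist e x y = dist e y x.
Proof.
suff le_d a b : dist e a b <= dist e b a by apply/eqP; rewrite eqn_leq !le_d.
case: (shortest_path b a) => p [bp _ pa <-].
have ap : path e a (rev (belast b p)).
  by rewrite -pa rev_path (eq_path (e' := e)) // => u v; rewrite e_sym.
have -> : size p = size (rev (belast b p)) by rewrite size_rev size_belast.
have {1}<- : last a (rev (belast b p)) = b; last exact: dist_le_path.
by case: p pa {bp ap} => [<-|c p _] //=; rewrite rev_cons last_rcons.
Qed.

Lemma dist_eq0 x y : (dist e x y == 0) = (x == y).
Proof.
apply/eqP/eqP => [d0 | ->].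
  by case: (shortest_path x y) => -[|a p] [_ _ /= + //]; rewrite d0.
by have := @dist_le_path y [::] isT; rewrite leqn0 => /eqP.
Qed.

Lemma dist_eq1 x y : (dist e x y == 1) = e x y.
Proof.
apply/eqP/idP => [d1 | xy].
  case: (shortest_path x y) => -[|a [|b p]] [+ _ /= + +]; rewrite d1 //.
  by rewrite /= andbT => xa <-.
apply/eqP; rewrite eqn_leq lt0n dist_eq0 adj_neq // andbT.
by apply: (@dist_le_path x [:: y]); rewrite /= xy.
Qed.

Lemma dist_eq2 x y z : e x y -> e y z -> x != z -> ~~ e x z -> dist e x z = 2.
Proof.
move=> xy yz; rewrite -dist_eq1 -dist_eq0.
have := @dist_le_path x [:: y; z]; rewrite /= xy yz => /(_ isT).
lia.
Qed.

Lemma dist_eq2_mid x z : dist e x z = 2 -> exists2 y, e x y & e y z.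
Proof.
move=> d2; case: (shortest_path x z) => -[|a [|b [|? ?]]] [+ _ /= + +]; rewrite d2 //.
by case/and3P=> xa ab _ <- _; exists a.
Qed.

Lemma exists_crossing_edge (A : pred T) x y :
  A x -> ~~ A y -> exists u v, [/\ A u, ~~ A v & e u v].
Proof.
move=> Ax; case/connectP: (e_conn x y) => p + ->.
elim: p x Ax => [|a p IH] x Ax /=; first by rewrite Ax.
case/andP=> xa ap; case: (boolP (A a)) => [Aa|NAa _]; first exact: IH.
by exists x, a.
Qed.

(** * Upper and lower bounds for the metric dimension *)

Lemma metric_dim_leC (S : {set T}) :
    {in S &, forall u v, (forall w, w \notin S -> dist e u w = dist e v w) -> u = v} ->
  metric_dim e <= #|T| - #|S|.
Proof.
move=> S_res; have cardS := cardsC S; apply: find_iota_le; last by lia.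
apply/existsP; exists (~: S); apply/andP; split; last by apply/eqP; lia.
apply/forallP=> u; apply/forallP=> v; apply/implyP=> neq_uv.
apply: contraNT neq_uv => /existsPn eq_d; apply/eqP.
have {}eq_d w : w \notin S -> dist e u w = dist e v w.
  by move=> wS; have := eq_d w; rewrite inE wS negbK => /eqP.
case: (boolP (u \in S)) => uS; last first.
  by apply/esym/eqP; rewrite -dist_eq0 -eq_d // dist_eq0.
case: (boolP (v \in S)) => vS; last first.
  by apply/eqP; rewrite -dist_eq0 eq_d // dist_eq0.
exact: S_res.
Qed.

Lemma metric_dimP : exists2 W : {set T}, resolving e W & #|W| = metric_dim e.
Proof.
have : [exists W : {set T}, resolving e W && (#|W| == metric_dim e)].
  apply: (@find_iotaP (fun k => [exists W : {set T}, resolving e W && (#|W| == k)])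
            _ #|T|) => //.
  apply/existsP; exists setT; rewrite cardsT eqxx andbT.
  apply/forallP=> u; apply/forallP=> v; apply/implyP=> neq_uv.
  apply/existsP; exists u; rewrite inE eq_sym (eqP (_ : dist e u u == 0)) ?dist_eq0 //.
  by rewrite eq_sym.
by case/existsP=> W /andP[? /eqP]; exists W.
Qed.

Lemma resolvingP (W : {set T}) u v :
  resolving e W -> {in W, forall w, dist e u w = dist e v w} -> u = v.
Proof.
move=> /forallP/(_ u)/forallP/(_ v)/implyP W_res eq_d.
case: (eqVneq u v) W_res => // _ /(_ isT)/existsP[w /andP[wW]].
by rewrite eq_d // eqxx.
Qed.

(** A shortest path from [a] can start at [b] instead, as both see its second vertex; if that vertex
    is [b] itself, dropping [a] shortens the path. *)
Lemma twin_dist u v w :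
    (forall y, y != u -> y != v -> e u y = e v y) -> w != u -> w != v ->
  dist e u w = dist e v w.
Proof.
suff le_d a b : (forall y, y != a -> y != b -> e a y = e b y) ->
    w != a -> dist e b w <= dist e a w.
  move=> uv wu wv; apply/eqP; rewrite eqn_leq !le_d // => y yv yu.
  by rewrite uv.
move=> ab wa; case: (shortest_path a w) => -[|c p] [].
  by move=> _ _ /= eq_a; rewrite eq_a eqxx in wa.
case/andP=> ac cp uacp cw <-; case: (eqVneq c b) => [eq_cb|cb].
  by subst c; rewrite -cw /= leqW // dist_le_path.
have bc : e b c by rewrite -ab // eq_sym adj_neq.
by rewrite -cw; apply: (@dist_le_path b (c :: p)); rewrite /= bc.
Qed.

(* The classes of [k] consist of twins (adjacent or not). *)
Lemma metric_dim_ge_twins (K : finType) (k : T -> K) :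
    (forall u v, k u = k v -> forall y, y != u -> y != v -> e u y = e v y) ->
  #|T| - #|K| <= metric_dim e.
Proof.
move=> twins; case: metric_dimP => W W_res <-.
suff : #|~: W| <= #|K| by have := cardsC W; lia.
have k_inj : {in ~: W &, injective k}.
  move=> u v; rewrite !inE => uW vW eq_k; apply: (resolvingP W_res) => w wW.
  by apply: (twin_dist (twins _ _ eq_k)); apply: contraTneq wW => ->.
by rewrite -(card_in_imset k_inj) max_card.
Qed.

Lemma cyclic_param s : is_cycle e s ->
  exists c : nat -> T,
    (forall k, e (c k) (c k.+1)) /\
    (forall i j, (c i == c j) = (i == j %[mod size s])).
Proof.
case: s => [|x s] // /andP[/andP[_ s_uniq] s_cycle].
exists (fun k => nth x (x :: s) (k %% (size s).+1)); split=> [k|i j].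
- have lt_k := ltn_pmod k (ltn0Sn (size s)).
  have := pathP x s_cycle (k %% (size s).+1).
  rewrite size_rcons => /(_ lt_k).
  rewrite -rcons_cons nth_rcons /= lt_k.
  suff -> : nth x (rcons s x) (k %% (size s).+1) = nth x (x :: s) (k.+1 %% (size s).+1) by [].
  rewrite nth_rcons -(addn1 k) -modnDml addn1; move: lt_k.
  rewrite ltnS leq_eqVlt => /orP[/eqP->|lt_k]; first by rewrite ltnn eqxx modnn.
  by rewrite lt_k (@modn_small (k %% _).+1).
by rewrite (nth_uniq x _ _ s_uniq) ?ltn_pmod.
Qed.

(** * Metric geometry of a shortest cycle *)

Section ShortestCycle.
(* A cycle is traversed by an infinite periodic walk, so that rotating it is
   just shifting the index. *)
Variable c : nat -> T.
Hypotheses (g_gt0 : 0 < girth e)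
           (c_adj : forall k, e (c k) (c k.+1))
           (c_eq : forall i j, (c i == c j) = (i == j %[mod girth e])).

Lemma cycle_neq i j : i < j -> j < i + girth e -> c i != c j.
Proof.
by move=> ij ji; rewrite c_eq eq_sym eqn_mod_dvd ?(ltnW ij) // gtnNdvd; lia.
Qed.

Lemma cycle_periodic k : c (k + girth e) = c k.
Proof. by apply/eqP; rewrite c_eq modnDr. Qed.

Lemma arc_path i l : path e (c i) [seq c k | k <- iota i.+1 l].
Proof. by elim: l i => //= l IH i; rewrite c_adj IH. Qed.

Lemma arc_last i l : last (c i) [seq c k | k <- iota i.+1 l] = c (i + l).
Proof. by elim: l i => [|l IH] i /=; rewrite ?addn0 // IH addSnnS. Qed.

Lemma arc_uniq i l : l < girth e -> uniq (c i :: [seq c k | k <- iota i.+1 l]).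
Proof.
move=> lg; rewrite -[_ :: _]/(map c (iota i l.+1)) map_inj_in_uniq ?iota_uniq //.
move=> a b; rewrite !mem_iota => ha hb eq_ab; apply/eqP; move/eqP: eq_ab.
by apply: contraTT; rewrite neq_ltn => /orP[] lt_ab; [|rewrite eq_sym]; apply: cycle_neq; lia.
Qed.

Lemma short_path_arc i l p :
    path e (c i) p -> uniq (c i :: p) -> last (c i) p = c (i + l) ->
    size p + l < girth e ->
  p = [seq c k | k <- iota i.+1 l].
Proof.
move=> ip up pl lt_g; apply: (short_path_unique ip (arc_path i l) up).
- by apply: arc_uniq; lia.
- by rewrite arc_last.
- by rewrite size_map size_iota.
Qed.

(** A path shorter than the arc would, with it, have total length below the girth, hence equal the
    arc by uniqueness of short paths. *)
Lemma dist_arc i l : l.*2 <= girth e -> dist e (c i) (c (i + l)) = l.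
Proof.
move=> lg; case: (shortest_path (c i) (c (i + l))) => p [ip up pl size_p].
have := dist_le_path (arc_path i l); rewrite arc_last size_map size_iota.
rewrite leq_eqVlt => /orP[/eqP //|lt_l].
have lt_g : size p + l < girth e by lia.
have := congr1 size (short_path_arc ip up pl lt_g).
by rewrite size_map size_iota size_p.
Qed.

Lemma dist_cycle i j :
  i <= j -> j < girth e -> dist e (c i) (c j) = minn (j - i) (girth e - (j - i)).
Proof.
move=> ij jg; case: (leqP (j - i).*2 (girth e)) => lg.
  by have := dist_arc i lg; rewrite subnKC // => ->; lia.
(* The long arc is replaced by the complementary one, from [c j] on to [c (i + girth e)]. *)
have lg' : (girth e - (j - i)).*2 <= girth e by lia.
have := dist_arc j lg'; rewrite (_ : j + _ = i + girth e); last by lia.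
by rewrite cycle_periodic dist_sym => ->; lia.
Qed.

Definition cycle_set : {set T} := [set c (val i) | i : 'I_(girth e)].

Lemma cycle_setP x : x \in cycle_set -> exists2 i, i < girth e & x = c i.
Proof. by case/imsetP=> i _ ->; exists (val i); rewrite ?ltn_ord. Qed.

Lemma mem_cycle_set k : c k \in cycle_set.
Proof.
apply/imsetP; exists (Ordinal (ltn_pmod k g_gt0)) => //=.
by apply/eqP; rewrite c_eq modn_mod.
Qed.

Lemma card_cycle_set : #|cycle_set| = girth e.
Proof.
rewrite card_imset ?card_ord // => i j /eqP; rewrite c_eq !modn_small ?ltn_ord //.
by move/eqP/val_inj.
Qed.

(** * A vertex off the cycle, for girth at least five *)

Section Outside.
Variable z : T.
Hypotheses (g5 : 4 < girth e) (zNc : forall k, z != c k).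

(** The path through [z] has length 2 and the arc length [l], at most half the girth. As the girth
    is at least 5, the total is below it, so the two coincide and [z] would lie on the cycle. *)
Lemma one_neighbour_arc i l : 0 < l -> l.*2 <= girth e ->
  e z (c i) -> e z (c (i + l)) -> False.
Proof.
move=> l0 lg zi zl; have : z \in [:: z; c (i + l)] by rewrite mem_head.
rewrite (@short_path_arc i l [:: z; c (i + l)]) /=.
- by case/mapP=> k _ eq_z; move: (zNc k); rewrite {1}eq_z eqxx.
- by rewrite zl e_sym zi.
- rewrite !inE negb_or eq_sym (zNc i) zNc !andbT /=.
  by apply: cycle_neq; lia.
- by [].
by lia.
Qed.

Lemma one_neighbour i : e z (c 0) -> 0 < i < girth e -> e z (c i) = false.
Proof.
move=> z0 /andP[i0 ig]; apply/negP => zi.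
case: (leqP i.*2 (girth e)) => lg; first exact: (@one_neighbour_arc 0 i).
apply: (@one_neighbour_arc i (girth e - i)) => //; try lia.
by rewrite subnKC 1?ltnW // -[girth e]add0n cycle_periodic.
Qed.

Lemma dist_outside i : e z (c 0) -> (i == 1) || (i == (girth e).-1) ->
  dist e z (c i) = 2.
Proof.
move=> z0 i1; apply: (dist_eq2 z0 _ (zNc i)); last by rewrite one_neighbour //; lia.
case/orP: i1 => /eqP ->; first exact: c_adj.
have := c_adj (girth e).-1; rewrite (prednK g_gt0).
by rewrite (cycle_periodic 0 : c (girth e) = c 0) e_sym.
Qed.

Lemma metric_dim_outside_ne6 : girth e != 6 -> e z (c 0) ->
  metric_dim e <= #|T| - (girth e).-1.
Proof.
move=> g6 z0.
have zNC : z \notin cycle_set.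
  by apply/negP => /cycle_setP[i _ eq_z]; move: (zNc i); rewrite {1}eq_z eqxx.
pose S := (z |: cycle_set) :\ c 1 :\ c (girth e).-1.
have -> : (girth e).-1 = #|S|.
  have := cardsU1 z cycle_set; rewrite (negbTE zNC) card_cycle_set.
  rewrite (cardsD1 (c 1)) (cardsD1 (c (girth e).-1) (_ :\ _)) -/S !inE !mem_cycle_set !orbT.
  by rewrite eq_sym cycle_neq //=; lia.
have c1 : c 1 \notin S by rewrite !inE eqxx andbF.
have cg : c (girth e).-1 \notin S by rewrite !inE eqxx.
have SP x : x \in S -> x = z \/ exists2 i, i < girth e & x = c i.
  rewrite !inE => /and3P[_ _ /orP[/eqP|/cycle_setP]]; by [left|right].
have dz1 := @dist_outside 1 z0 isT.
have dzg : dist e z (c (girth e).-1) = 2 by apply: dist_outside; rewrite ?eqxx ?orbT.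
have d1 i : 0 < i -> i < girth e -> dist e (c i) (c 1) = minn (i - 1) (girth e - (i - 1)).
  by move=> i0 ig; rewrite dist_sym dist_cycle.
have d10 : dist e (c 0) (c 1) = 1 by apply/eqP; rewrite dist_eq1.
have dg i : i < girth e ->
    dist e (c i) (c (girth e).-1) = minn ((girth e).-1 - i) (girth e - ((girth e).-1 - i)).
  by move=> ig; rewrite dist_cycle //; lia.
(* Distance 2 from both landmarks would force [i = 3] and [i = girth e - 3], that is, girth 6. *)
have zc i : i < girth e -> dist e z (c 1) = dist e (c i) (c 1) ->
    dist e z (c (girth e).-1) = dist e (c i) (c (girth e).-1) -> False.
  move=> ig; rewrite dz1 dzg (dg i ig).
  by case: i ig => [|i] ig; rewrite ?d10 ?d1 //; lia.
apply: metric_dim_leC => u v /SP[->|[i ig ->]] /SP[->|[j jg ->]] eq_d //.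
- by case: (zc j) => //; apply: eq_d.
- by case: (zc i) => //; symmetry; apply: eq_d.
(* Distinct [c i], [c j] equidistant from [c 1] have [i + j = 2] modulo the girth, and from the
   other landmark [i + j = -2]; the girth would divide 4. *)
congr c; have := eq_d _ cg; have := eq_d _ c1; rewrite !dg //.
by case: i j ig jg {eq_d} => [|i] [|j] ig jg; rewrite ?d10 ?d1 //; lia.
Qed.

Lemma metric_dim_outside_eq6 : girth e = 6 -> e z (c 0) ->
  metric_dim e <= #|T| - (girth e).-1.
Proof.
move=> g6 z0.
have zNC : z \notin cycle_set.
  by apply/negP => /cycle_setP[i _ eq_z]; move: (zNc i); rewrite {1}eq_z eqxx.
pose S := cycle_set :\ c 1.
have -> : (girth e).-1 = #|S|.
  by have := cardsD1 (c 1) cycle_set; rewrite card_cycle_set mem_cycle_set -/S; lia.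
have c1 : c 1 \notin S by rewrite !inE eqxx.
have zS : z \notin S by rewrite !inE (negbTE zNC) andbF.
have z_adj i : 0 < i < 6 -> e z (c i) = false by rewrite -g6; apply: one_neighbour.
have d_cyc i j : i <= j -> j < 6 -> dist e (c i) (c j) = minn (j - i) (6 - (j - i)).
  by rewrite -g6; apply: dist_cycle.
have res02 : dist e (c 0) z <> dist e (c 2) z.
  have /eqP-> : dist e (c 0) z == 1 by rewrite dist_eq1 e_sym.
  by move/esym/eqP; rewrite dist_eq1 e_sym z_adj.
have res35 : (forall w, w \notin S -> dist e (c 3) w = dist e (c 5) w) -> False.
  move=> eq_d; have dz5 : dist e z (c 5) = 2 by apply: dist_outside; rewrite ?g6.
  have : dist e z (c 3) = 2 by rewrite dist_sym eq_d // dist_sym.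
  case/dist_eq2_mid=> w zw w3.
  (* On the cycle [z] sees only [c 0], which is not adjacent to [c 3]. So [w] is off the cycle and
     may serve as a landmark. *)
  have wNC : w \notin cycle_set.
    apply/negP => /cycle_setP[i ig eq_w]; subst w.
    case: (posnP i) => [i0|i0]; last by rewrite z_adj ?i0 // -g6 in zw.
    by move: w3; rewrite i0 -dist_eq1 d_cyc.
  have wNc k : w != c k by apply: contraNneq wNC => ->; apply: mem_cycle_set.
  have wS : w \notin S by rewrite !inE (negbTE wNC) andbF.
  have := eq_d w wS; have /eqP-> : dist e (c 3) w == 1 by rewrite dist_eq1 e_sym.
  move/esym/eqP; rewrite dist_eq1 e_sym => w5.
  (* z w c_5 and z c_0 c_5 would be two paths of total length 4 < 6. *)
  have c50 : e (c 5) (c 0) by rewrite e_sym -dist_eq1 d_cyc.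
  have := @short_path_unique z [:: w; c 5] [:: c 0; c 5].
  rewrite /= zw w5 z0 e_sym c50 !inE !negb_or !(adj_neq zw) !zNc wNc g6 /=.
  have -> : c 0 != c 5 by apply: cycle_neq; rewrite ?g6.
  by move=> /(_ isT isT isT isT erefl isT) [/eqP]; rewrite (negbTE (wNc 0)).
have SP x : x \in S -> exists2 i, (i < 6) && (i != 1) & x = c i.
  rewrite !inE => /andP[x1 /cycle_setP[i ig eq_x]]; exists i => //.
  by rewrite -g6 ig; apply: contraNneq x1 => i1; rewrite eq_x i1.
apply: metric_dim_leC => u v /SP[i i6 ->] /SP[j j6 ->] {u v}.
wlog ij : i j i6 j6 / i <= j => [wl eq_d|eq_d].
  case: (leqP i j) => [|/ltnW] ij; first exact: wl.
  by symmetry; apply: wl => // w wS; rewrite eq_d.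
congr c; move: (eq_d _ c1) (eq_d _ zS) => eq1 eqz; apply/eqP.
have d1 k : 0 < k < 6 -> dist e (c k) (c 1) = minn (k - 1) (6 - (k - 1)).
  by case/andP=> k0 k6; rewrite dist_sym d_cyc.
have d10 : dist e (c 0) (c 1) = 1 by apply/eqP; rewrite dist_eq1.
(* Equidistance from [c 1] means [i + j = 2] modulo 6, so the only pairs left are 0, 2 and 3, 5. *)
case: (posnP i) => [i0|i0]; last first.
  rewrite !d1 in eq1; [|lia..].
  case: (eqVneq i j) => // neq_ij; exfalso; apply: res35.
  by have [<- <-] : i = 3 /\ j = 5 by lia.
subst i; case: (posnP j) => [->//|j0]; rewrite d10 d1 in eq1; [|lia].
by exfalso; apply: res02; have <- : j = 2 by lia.
Qed.

End Outside.


(** * The case where the cycle contains every vertex *)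

Lemma mem_cycle_set_full x : #|T| = girth e -> x \in cycle_set.
Proof.
move=> gT; suff -> : cycle_set = setT by rewrite inE.
by apply/eqP; rewrite eqEcard subsetT cardsT card_cycle_set gT leqnn.
Qed.

Lemma cycle_adj i j : i <= j -> j < girth e ->
  e (c i) (c j) = (j == i.+1) || (i == 0) && (j == (girth e).-1) && (i < j).
Proof.
move=> ij jg; rewrite -dist_eq1 // dist_cycle //; apply/idP/idP; lia.
Qed.

Lemma isomorphic_cycle_graph :
  2 < girth e -> #|T| = girth e -> isomorphic e (cycle_graph #|T|).
Proof.
move=> g3 gT; rewrite gT.
apply: (@isomorphic_inv _ _ _ _ (fun i : 'I_(girth e) => c i)).
- by move=> i j /eqP; rewrite c_eq !modn_small ?ltn_ord // => /eqP/val_inj.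
- by rewrite card_ord gT.
suff adj_le (i j : 'I_(girth e)) : i <= j -> e (c i) (c j) = cycle_graph _ i j.
  move=> i j; case: (leqP i j) => [|/ltnW] ij; first exact: adj_le.
  by rewrite e_sym adj_le // /cycle_graph orbC.
move=> ij; have ig := ltn_ord i; have jg := ltn_ord j.
rewrite cycle_adj // /cycle_graph /= !succ_modn //.
by case: ifP; case: ifP; lia.
Qed.

(** Distinct [c i], [c j] equidistant from [c 0] and [c 1] would have [i + j] equal to both 0 and 2
    modulo the girth, which exceeds 2. *)
Lemma metric_dim_cycle_le : 2 < girth e -> #|T| = girth e -> metric_dim e <= 2.
Proof.
move=> g3 gT; pose S := [set: T] :\ c 0 :\ c 1.
have c01 : c 0 != c 1 by apply: cycle_neq; lia.
have card_S : #|S| = #|T| - 2.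
  have := cardsD1 (c 0) [set: T]; rewrite (cardsD1 (c 1) (_ :\ _)) cardsT -/S !inE.
  by rewrite eq_sym c01; lia.
have c0S : c 0 \notin S by rewrite !inE eqxx andbF.
have c1S : c 1 \notin S by rewrite !inE eqxx.
suff : metric_dim e <= #|T| - #|S| by lia.
apply: metric_dim_leC => // u v _ _ eq_d.
case/cycle_setP: (mem_cycle_set_full u gT) => i ig eq_u.
case/cycle_setP: (mem_cycle_set_full v gT) => j jg eq_v; subst u v.
congr c; have := eq_d _ c1S; have := eq_d _ c0S.
rewrite !(dist_sym _ (c 0)) (dist_cycle (leq0n _) ig) (dist_cycle (leq0n _) jg).
have d10 : dist e (c 0) (c 1) = 1 by apply/eqP; rewrite dist_eq1.
have d1 k : 0 < k -> k < girth e -> dist e (c k) (c 1) = minn (k - 1) (girth e - (k - 1)).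
  by move=> k0 kg; rewrite dist_sym // dist_cycle.
by case: i j ig jg {eq_d} => [|i] [|j] ig jg; rewrite ?d10 ?d1 //; lia.
Qed.

Lemma metric_dim_cycle_ge2 : 2 < girth e -> #|T| = girth e -> 2 <= metric_dim e.
Proof.
move=> g3 gT; case: metric_dimP => W W_res <-.
rewrite ltnNge; apply/negP => /card_le1_eqP W1.
have [w Ww] : exists w, {in W, forall v, v = w}.
  have [->|[w wW]] := set_0Vmem W; first by exists (c 0) => v; rewrite inE.
  by exists w => v vW; apply: W1.
case/cycle_setP: (mem_cycle_set_full w gT) => i ig eq_w; subst w.
(* These are the two neighbours of the only landmark, both at distance 1; the predecessor is reached
   by going [girth e - 1] steps forward. *)
have : c i.+1 != c (i + (girth e).-1) by apply: cycle_neq; lia.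
case/eqP; apply: (resolvingP W_res) => v /Ww ->.
have /eqP-> : dist e (c i.+1) (c i) == 1 by rewrite dist_eq1 // e_sym.
apply/esym/eqP; rewrite dist_eq1 // -(cycle_periodic i).
by have := c_adj (i + (girth e).-1); rewrite -addnS (prednK g_gt0).
Qed.

End ShortestCycle.

(** * Consequences of the existence of a cycle *)

Hypothesis e_cyc : has_cycle e.

Lemma shortest_cycle_param : exists c : nat -> T,
  (forall k, e (c k) (c k.+1)) /\ (forall i j, (c i == c j) = (i == j %[mod girth e])).
Proof.
by case/girthP: e_cyc => s /cyclic_param + <-.
Qed.

(** An edge leaving a shortest cycle would give one of its vertices a third neighbour. *)
Lemma girth_max_degree2 :
    (forall x y1 y2 y3, e x y1 -> e x y2 -> e x y3 -> y1 != y2 -> y3 = y1 \/ y3 = y2) ->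
  #|T| = girth e.
Proof.
move=> deg2; have g3 := girth_ge3 e_cyc; have g0 : 0 < girth e by lia.
case: shortest_cycle_param => c [c_adj c_eq].
apply/eqP; rewrite eqn_leq girth_le_card // andbT -(card_cycle_set c_eq).
rewrite -cardsT; apply: subset_leq_card; apply/subsetP => y _.
apply/negPn/negP => yNC.
have [u [v []]] := exists_crossing_edge (A := mem (cycle_set c)) (mem_cycle_set g0 c_eq 0) yNC.
move=> /cycle_setP[i ig ->] /negP vNC cv; apply: vNC.
have cp : e (c i) (c (i + (girth e).-1)).
  have := c_adj (i + (girth e).-1).
  by rewrite e_sym -addnS (prednK g0) (cycle_periodic c_eq).
have np : c i.+1 != c (i + (girth e).-1) by apply: (cycle_neq g0 c_eq); lia.
by case: (deg2 _ _ _ _ (c_adj i) cp cv np) => ->; apply: mem_cycle_set.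
Qed.

Lemma metric_dim_girth_ge5 : 4 < girth e -> girth e < #|T| ->
  metric_dim e <= #|T| - (girth e).-1.
Proof.
move=> g5 gT; have g0 : 0 < girth e by lia.
case: shortest_cycle_param => c [c_adj c_eq].
have /subsetPn[y _ yNC] : ~~ ([set: T] \subset cycle_set c).
  by apply: contraL gT => /subset_leq_card; rewrite cardsT card_cycle_set // leqNgt.
have [u [z []]] := exists_crossing_edge (A := mem (cycle_set c)) (mem_cycle_set g0 c_eq 0) yNC.
move=> /cycle_setP[i ig ->] /negP zNC cz.
(* The cycle is rotated so that the neighbour of [z] gets index 0. *)
pose d k := c (k + i).
have d_adj k : e (d k) (d k.+1) by apply: c_adj.
have d_eq k l : (d k == d l) = (k == l %[mod girth e]) by rewrite c_eq eqn_modDr.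
have zNd k : z != d k.
  by apply/eqP => eq_z; apply: zNC; rewrite eq_z; apply: mem_cycle_set.
have zd0 : e z (d 0) by rewrite e_sym.
case: (eqVneq (girth e) 6) => g6.
  exact: (metric_dim_outside_eq6 g0 d_adj d_eq g5 zNd).
exact: (metric_dim_outside_ne6 g0 d_adj d_eq g5 zNd).
Qed.

Lemma complete_of_metric_dim : #|T| - 2 < metric_dim e -> forall x y, e x y = (x != y).
Proof.
move=> dim_gt x y; apply/idP/idP => [|xy]; first exact: adj_neq.
pose A := [pred u | (u == x) || e x u]; have Ax : A x by rewrite /= eqxx.
case: (boolP (A y)) => [/=|yNA]; first by rewrite eq_sym (negbTE xy).
(* An edge leaving the closed neighbourhood of [x] yields an induced path [x u v]. *)
have [u [v [/= xu]]] := exists_crossing_edge Ax yNA.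
rewrite negb_or => /andP[vx xv] uv; exfalso.
have {}xu : e x u by case/orP: xu xv => // /eqP <-; rewrite uv.
move: dim_gt; rewrite ltnNge => /negP; apply.
have <- : #|[set u; v]| = 2 by rewrite cards2 (adj_neq uv).
have xS : x \notin [set u; v] by rewrite !inE negb_or (adj_neq xu) eq_sym.
have dxu : dist e u x = 1 by apply/eqP; rewrite dist_eq1 // e_sym.
have dxv : dist e v x != 1 by rewrite dist_eq1 // e_sym.
apply: metric_dim_leC => // a b; rewrite !inE.
move=> /orP[]/eqP-> /orP[]/eqP-> // /(_ x xS); rewrite dxu => eq_d.
  by rewrite -eq_d in dxv.
by rewrite eq_d in dxv.
Qed.

(** * Four-cycles in triangle-free graphs *)

Section TriangleFree.
Hypothesis g4 : 3 < girth e.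

(** A 4-cycle in cyclic order, primes marking opposite vertices. Only opposite vertices get an
    explicit inequality; adjacent ones differ by irreflexivity. *)
Definition quad a b a' b' :=
  [&& e a b, e b a', e a' b', e b' a, a != a' & b != b'].

Lemma quad_swap a b a' b' : quad a b a' b' -> quad b a b' a'.
Proof.
case/and5P=> ab ba' a'b' b'a /andP[aa' bb'].
by rewrite /quad e_sym ab e_sym b'a e_sym a'b' e_sym ba' aa' bb'.
Qed.

Lemma metric_dim_quad a b a' b' z :
  quad a b a' b' -> e z a -> ~~ e z a' -> metric_dim e <= #|T| - 3.
Proof.
case/and5P=> ab ba' a'b' b'a /andP[aa' bb'] za za'.
have aNa' : ~~ e a a' by rewrite (triangle_free g4 ab ba').
have bNb' : ~~ e b b' by rewrite (triangle_free g4 ba' a'b').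
have zNb' : ~~ e z b'.
  by rewrite e_sym (triangle_free g4 b'a) // e_sym.
have [za_ne ab_ne] := (adj_neq za, adj_neq ab).
have [ba'_ne [a'b'_ne b'a_ne]] := (adj_neq ba', (adj_neq a'b', adj_neq b'a)).
have zS : z \notin a |: [set a'; b'].
  rewrite !inE !negb_or za_ne /=; apply/andP; split.
    by apply: contraNneq aNa' => <-; rewrite e_sym.
  by apply: contraNneq za' => ->; rewrite e_sym.
have bS : b \notin a |: [set a'; b'] by rewrite !inE !negb_or eq_sym ab_ne ba'_ne.
have <- : #|a |: [set a'; b']| = 3.
  by rewrite cardsU1 cards2 a'b'_ne !inE negb_or aa' eq_sym b'a_ne.
have sep w u v : e w u -> ~~ e w v -> dist e u w != dist e v w.
  move=> wu wv; have /eqP-> : dist e u w == 1 by rewrite dist_eq1 // e_sym.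
  by rewrite eq_sym dist_eq1 // e_sym.
apply: metric_dim_leC => // u v uS vS eq_d.
have dz : e z u = e z v by rewrite !(e_sym z) -!dist_eq1 // eq_d.
have db : e b u = e b v by rewrite !(e_sym b) -!dist_eq1 // eq_d.
(* The adjacencies to [z] and [b] are yes/yes for [a], no/yes for [a'] and no/no for [b']. *)
move: uS vS dz db; rewrite !inE => /or3P[]/eqP-> /or3P[]/eqP-> //;
  by rewrite ?za ?(negbTE za') ?(negbTE zNb') ?ba' ?(negbTE bNb').
Qed.

Hypothesis dim_gt : #|T| - 3 < metric_dim e.

Lemma quad_twin a b a' b' z : quad a b a' b' -> e z a -> e z a'.
Proof.
move=> q za; apply: contraLR dim_gt => za'.
by rewrite -leqNgt (metric_dim_quad q za za').
Qed.

(** A neighbour [x] of [b] also sees [b'], so [x] and [a] are opposite on a 4-cycle, and [quad_twin]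
    applies in both directions. *)
Lemma quad_neighbours a b a' b' x : quad a b a' b' -> e b x -> e x =1 e a.
Proof.
move=> q bx y; case: (eqVneq x a) => [->//|xa].
have b'x : e b' x by rewrite e_sym (quad_twin (quad_swap q)) // e_sym.
case/and5P: q => ab _ _ b'a /andP[_ bb'].
have q1 : quad x b a b' by rewrite /quad e_sym bx e_sym ab e_sym b'a b'x xa bb'.
have q2 : quad a b' x b.
  by rewrite /quad e_sym b'a b'x e_sym bx e_sym ab eq_sym xa eq_sym bb'.
by apply/idP/idP; rewrite e_sym => h; rewrite e_sym;
  [apply: (quad_twin q1) | apply: (quad_twin q2)].
Qed.

(** The sides are the neighbourhoods [A] of [b] and [B] of [a]. Every vertex of [A] has
    neighbourhood [B] and conversely, so no edge leaves their union, which is everything by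
    connectedness. *)
Lemma isomorphic_complete_bipartite a b a' b' : quad a b a' b' ->
  exists r s, [/\ 2 <= r, 2 <= s & isomorphic e (complete_bipartite r s)].
Proof.
move=> q; pose A := [set x | e b x]; pose B := [set x | e a x].
have NA x : x \in A -> e x =1 e a by rewrite inE; apply: quad_neighbours q.
have NB x : x \in B -> e x =1 e b.
  by rewrite inE; apply: (quad_neighbours (quad_swap q)).
case/and5P: (q) => ab ba' a'b' b'a /andP[aa' bb'].
have cover x : x \in A :|: B.
  apply/negPn/negP => xN.
  have aA : a \in A :|: B by rewrite !inE e_sym ab.
  have [u [v []]] := exists_crossing_edge (A := mem (A :|: B)) aA xN.
  rewrite [mem _ u]inE => /orP[/NA uE|/NB uE]; rewrite [mem _ v]inE !inE uE => + uv.
    by rewrite uv orbT.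
  by rewrite uv.
have disj x : x \in A -> x \in B -> False.
  by rewrite !inE => bx; rewrite (triangle_free g4 ab bx).
exists #|A|, #|B|; split.
- by apply/card_gt1P; exists a, a'; rewrite !inE e_sym ab ba' aa'.
- by apply/card_gt1P; exists b, b'; rewrite !inE ab e_sym b'a bb'.
pose h (x : 'I_#|A| + 'I_#|B|) :=
  match x with inl i => enum_val i | inr j => enum_val j end.
apply: (@isomorphic_inv _ _ _ _ h).
- move=> [i|i] [j|j] /= eq_h.
  + by rewrite (enum_val_inj eq_h).
  + by case: (disj (enum_val i)); rewrite ?enum_valP // eq_h enum_valP.
  + by case: (disj (enum_val j)); rewrite ?enum_valP // -eq_h enum_valP.
  + by rewrite (enum_val_inj eq_h).
- rewrite card_sum !card_ord -cardsT (_ : setT = A :|: B) ?cardsU ?leq_subr //.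
  by apply/setP => x; rewrite cover inE.
have AB i j : e (h (inl i)) (h (inr j)).
  by rewrite /= (NA _ (enum_valP i)); have := enum_valP j; rewrite inE.
move=> [i|i] [j|j]; rewrite ?AB //=.
- apply/negP; rewrite (NA _ (enum_valP i)) => eaj.
  by apply: (disj (enum_val j)); rewrite ?enum_valP // inE.
- by rewrite e_sym; apply: AB.
apply/negP; rewrite (NB _ (enum_valP i)) => ebj.
by apply: (disj (enum_val j)); rewrite ?enum_valP // inE.
Qed.

End TriangleFree.

(** * From the extremal value to the three families *)

Lemma girth4_quad : girth e = 4 -> exists a b a' b', quad a b a' b'.
Proof.
move=> g4; case/girthP: e_cyc => s /andP[/andP[_ +] +].
rewrite g4; case: s => [|a [|b [|a' [|b' [|]]]]] //= + + _.
rewrite !inE !negb_or => /and4P[/and3P[_ aa' _] /andP[_ bb'] _ _].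
case/and5P=> ab ba' a'b' b'a _; exists a, b, a', b'.
by rewrite /quad ab ba' a'b' b'a aa' bb'.
Qed.

(** Girth 3 leads to complete graphs, girth 4 to complete bipartite ones and larger girth to cycles;
    the cycles on 3 and 4 vertices thus appear as a complete and a complete bipartite graph. *)
Lemma extremal_family : metric_dim e = #|T| - girth e + 2 ->
  [\/ 3 <= #|T| /\ isomorphic e (cycle_graph #|T|),
      3 <= #|T| /\ isomorphic e (complete_graph #|T|)
    | exists r s : nat, [/\ 2 <= r, 2 <= s & isomorphic e (complete_bipartite r s)]].
Proof.
move=> dim_eq; have g3 := girth_ge3 e_cyc; have gT := girth_le_card e_cyc.
case: (ltngtP (girth e) 4) => [g4|g4|g4].
- apply: Or32; split; first by lia.
  have eE := complete_of_metric_dim (_ : #|T| - 2 < metric_dim e).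
  apply: (@isomorphic_inv _ _ _ _ (@enum_val T T)) => [||i j].
  + exact: enum_val_inj.
  + by rewrite card_ord.
  by rewrite eE ?(inj_eq enum_val_inj) //; lia.
- apply: Or31; split; first by lia.
  case: (ltnP (girth e) #|T|) => [/(metric_dim_girth_ge5 g4)|Tg]; first by lia.
  case: shortest_cycle_param => c [c_adj c_eq].
  by apply: (isomorphic_cycle_graph _ c_adj c_eq); lia.
- apply: Or33; case: (girth4_quad g4) => a [b [a' [b' q]]].
  by apply: isomorphic_complete_bipartite q; lia.
Qed.

(** * The metric dimension of each family *)

Lemma metric_dim_cycle :
  isomorphic e (cycle_graph #|T|) -> metric_dim e = #|T| - girth e + 2.
Proof.
case=> f [f_bij fE]; have g3 := girth_ge3 e_cyc.
have gT : #|T| = girth e.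
  apply: girth_max_degree2 => x y1 y2 y3; rewrite -!fE -(inj_eq (bij_inj f_bij)).
  suff : cycle_graph _ (f x) (f y1) -> cycle_graph _ (f x) (f y2) ->
      cycle_graph _ (f x) (f y3) -> f y1 != f y2 -> f y3 = f y1 \/ f y3 = f y2.
    by move=> H h1 h2 h3 h4; case: (H h1 h2 h3 h4) => /(bij_inj f_bij); [left|right].
  move: (f x) (f y1) (f y2) (f y3) => i j k l; rewrite /cycle_graph !succ_modn ?ltn_ord //.
  have [[hi hj] [hk hl]] := ((ltn_ord i, ltn_ord j), (ltn_ord k, ltn_ord l)).
  rewrite -!val_eqE /= => h1 h2 h3 h4.
  suff : val l = val j \/ val l = val k by case=> /val_inj ->; [left|right].
  by move: h1 h2 h3 h4 => /=; do ?case: ifP; lia.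
case: shortest_cycle_param => c [c_adj c_eq]; have g0 : 0 < girth e by lia.
have := metric_dim_cycle_le g0 c_adj c_eq g3 gT.
have := metric_dim_cycle_ge2 g0 c_adj c_eq g3 gT.
by rewrite gT subnn; lia.
Qed.

Lemma metric_dim_complete : 3 <= #|T| ->
  isomorphic e (complete_graph #|T|) -> metric_dim e = #|T| - girth e + 2.
Proof.
move=> T3 [f [f_bij fE]].
have eE x y : e x y = (x != y) by rewrite -fE /complete_graph (inj_eq (bij_inj f_bij)).
have g3 : girth e = 3.
  apply/eqP; rewrite eqn_leq girth_ge3 // andbT.
  case/card_gt2P: T3 => x [y [z [_ [xy yz zx]]]].
  apply: (@girth_le [:: x; y; z]).
  by rewrite /is_cycle /= !eE !inE !negb_or xy yz (eq_sym x z) zx.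
(* All vertices of a complete graph form a single twin class. *)
have dim_ge : #|T| - #|{: unit}| <= metric_dim e.
  apply: (metric_dim_ge_twins (k := fun=> tt)).
  by move=> u v _ y yu yv; rewrite !eE !(eq_sym _ y) yu yv.
have /card_gt0P[x _] : 0 < #|T| by lia.
suff : metric_dim e <= #|T| - #|[set x]| by move: dim_ge; rewrite cards1 card_unit g3; lia.
by apply: metric_dim_leC => // u v; rewrite !inE => /eqP-> /eqP->.
Qed.

Lemma metric_dim_complete_bipartite r s : 2 <= r -> 2 <= s ->
  isomorphic e (complete_bipartite r s) -> metric_dim e = #|T| - girth e + 2.
Proof.
move=> r2 s2 [f [f_bij fE]].
pose k x := if f x is inl _ then true else false.
have eE x y : e x y = (k x != k y).
  by rewrite -fE /k; case: (f x) (f y) => [i|i] [j|j].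
case: (f_bij) => h fh hf.
pose a i : T := h (inl i); pose b j : T := h (inr j).
have ka i : k (a i) = true by rewrite /k /a hf.
have kb j : k (b j) = false by rewrite /k /b hf.
have inj_a : injective a by move=> i j /(can_inj hf)[].
have inj_b : injective b by move=> i j /(can_inj hf)[].
pose i0 := Ordinal (ltnW r2); pose i1 := Ordinal r2.
pose j0 := Ordinal (ltnW s2); pose j1 := Ordinal s2.
have ab i j : a i != b j by apply/eqP => /(congr1 k); rewrite ka kb.
have g4 : girth e = 4.
  apply/eqP; rewrite eqn_leq; apply/andP; split.
    apply: (@girth_le [:: a i0; b j0; a i1; b j1]).
    rewrite /is_cycle /= !eE !ka !kb !inE !negb_or !ab (eq_sym (b j0)) !ab.
    by rewrite (inj_eq inj_a) (inj_eq inj_b).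
  (* The side alternates along edges, so there is no closed walk of length 3. *)
  case: (girthP e_cyc) => c /andP[/andP[+ _] +] <-; case: c => [|x [|y [|z []]]] //= _.
  by rewrite !eE; case: (k x) (k y) (k z) => [] [] [].
have dim_ge : #|T| - #|{: bool}| <= metric_dim e.
  apply: (metric_dim_ge_twins (k := k)).
  by move=> u v eq_k y _ _; rewrite !eE eq_k.
(* One vertex is left out on each side; [a i1] is adjacent to [b j0] but not to [a i0]. *)
suff : metric_dim e <= #|T| - #|[set a i0; b j0]| by move: dim_ge (girth_le_card e_cyc); rewrite cards2 ab card_bool g4; lia.
have i1S : a i1 \notin [set a i0; b j0].
  by rewrite !inE negb_or ab andbT (inj_eq inj_a).
have da : dist e (a i0) (a i1) != 1 by rewrite dist_eq1 // eE !ka.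
have db : dist e (b j0) (a i1) = 1 by apply/eqP; rewrite dist_eq1 // eE ka kb.
apply: metric_dim_leC => // u v; rewrite !inE.
move=> /orP[]/eqP-> /orP[]/eqP-> // /(_ _ i1S); rewrite db => eq_d.
  by rewrite eq_d in da.
by rewrite -eq_d in da.
Qed.

End Connected.
End Graph.

Theorem theorem2p5 (T : finType) (e : rel T)
  (e_sym : symmetric e) (e_irr : irreflexive e)
  (e_conn : connected_graph e) (e_cyc : has_cycle e) :
  metric_dim e = #|T| - girth e + 2 <->
  [\/ 3 <= #|T| /\ isomorphic e (cycle_graph #|T|),
      3 <= #|T| /\ isomorphic e (complete_graph #|T|)
    | exists r s : nat, [/\ 2 <= r, 2 <= s & isomorphic e (complete_bipartite r s)]].
Proof.
split; first exact: extremal_family.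
case=> [[_ iso] | [T3 iso] | [r [s [r2 s2 iso]]]].
- exact: metric_dim_cycle.
- exact: metric_dim_complete.
- exact: metric_dim_complete_bipartite iso.
Qed.
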